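(* Let $n\ge 2$ be an integer. If $X$ and $Y$ are homotopy equivalent topological spaces, then $\operatorname{TC}^{\Sigma}_n(X)=\operatorname{TC}^{\Sigma}_n(Y)$; that is, $\operatorname{TC}^{\Sigma}_n(X)$ is a homotopy invariant of $X$.
   Context: Let $J_n$ be the wedge of $n$ copies of $[0,1]$, each with base point $0$, and let $1_i$ denote the point $1$ in the $i$-th copy. Let $X^{J_n}$ be the space of continuous maps $J_n\to X$ (compact-open topology) and $e_n:X^{J_n}\to X^n$, $e_n(\gamma)=(\gamma(1_1),\ldots,\gamma(1_n))$. An element $\gamma\in X^{J_n}$ is written $\{\gamma_j\}_{j=1}^n$, with $\gamma_j$ the restriction to the $j$-th interval. The symmetric group $\Sigma_n$ acts on $X^n$ by permuting coordinates and correspondingly on $X^{J_n}$ by permuting the paths $\gamma_j$, so that $e_n$ is $\Sigma_n$-equivariant. A subset $A\subseteq X^n$ is symmetric if $\sigma A=A$ for all $\sigma\in\Sigma_n$; a map $s:A\to X^{J_n}$ on a symmetric $A$ is equivariant if $\sigma(s(a))=s(\sigma(a))$ for all $a\in A$, $\sigma\in\Sigma_n$. $\operatorname{TC}^{\Sigma}_n(X)$ is the least integer $k$ such that $X^n=A_0\cup A_1\cup\cdots\cup A_k$ where each $A_i$ is open, symmetric and admits a continuous equivariant section $s_i:A_i\to X^{J_n}$ of $e_n$ (and is $\infty$ if no such $k$ exists). *)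

(* Defs.v *)
From HB Require Import structures.
From mathcomp Require Import all_boot all_order all_algebra all_fingroup.
From mathcomp Require Import all_classical all_reals topology normedtype homotopy.

Set Implicit Arguments.
Unset Strict Implicit.
Unset Printing Implicit Defensive.

Import Order.TTheory GRing.Theory Num.Theory.
Import numFieldNormedType.Exports.
(* Gives [continuousType U V] the compact-open topology in this file. *)
Import ArrowAsCompactOpen.

Local Open Scope classical_set_scope.
Local Open Scope ring_scope.

(* As a type, this is [set_type (unit_itv R)], with the subspace topology. *)
Definition unit_itv (R : realType) : set R := `[0, 1].
Arguments unit_itv R : clear implicits.

Section Endpoints.
Variable R : realType.

Fact itv0_subproof : (0 : R) \in unit_itv R.
Proof. by rewrite inE /unit_itv /= in_itv /= lexx ler01. Qed.

Fact itv1_subproof : (1 : R) \in unit_itv R.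
Proof. by rewrite inE /unit_itv /= in_itv /= ler01 lexx. Qed.

Definition itv0 : unit_itv R := exist _ 0 itv0_subproof.
Definition itv1 : unit_itv R := exist _ 1 itv1_subproof.

End Endpoints.

Section HomotopyEquivalence.
Variable R : realType.

Definition homotopic (X Y : topologicalType) (f g : X -> Y) : Prop :=
  exists H : X * unit_itv R -> Y,
    [/\ continuous H,
        forall x, H (x, itv0 R) = f x &
        forall x, H (x, itv1 R) = g x].

Definition homotopy_equivalent (X Y : topologicalType) : Prop :=
  exists (f : continuousType X Y) (g : continuousType Y X),
    homotopic (g \o f) idfun /\ homotopic (f \o g) idfun.

End HomotopyEquivalence.

Section Star.
Variables (R : realType) (n : nat).

Definition star : topologicalType := wedge (fun _ : 'I_n => itv0 R).

Definition star_in (i : 'I_n) (t : unit_itv R) : star :=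
  @wedge_lift 'I_n (fun=> unit_itv R) (fun=> itv0 R) i t.

Definition star_perm (s : 'S_n) : star -> star :=
  wedge_fun (fun i t => star_in (s i) t).

Fact star_perm_continuous (s : 'S_n) : continuous (star_perm s).
Proof.
apply: wedge_fun_continuous => [i|i j].
  exact: (@wedge_lift_continuous _ (fun=> unit_itv R) (fun=> itv0 R)).
exact: (@wedge_liftE _ (fun=> unit_itv R) (fun=> itv0 R) _ (itv0 R) _ (itv0 R)).
Qed.

HB.instance Definition _ (s : 'S_n) :=
  isContinuous.Build star star (star_perm s) (@star_perm_continuous s).

Lemma star_perm_in (s : 'S_n) i t : star_perm s (star_in i t) = star_in (s i) t.
Proof.
rewrite /star_perm /star_in wedge_lift_funE // => j k.
exact: (@wedge_liftE _ (fun=> unit_itv R) (fun=> itv0 R) _ (itv0 R) _ (itv0 R)).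
Qed.

End Star.

Section SymmetricTC.
Variables (R : realType) (n : nat) (X : topologicalType).

Local Notation "X ^n" := {ptws 'I_n -> X} (at level 2).
Local Notation XJ := (continuousType (star R n) X).

Definition star_ends (g : XJ) : X^n := fun i => g (star_in i (itv1 R)).

(* [(s * t)%g i = t (s i)] in ['S_n], so precomposition is a left action. *)
Definition perm_pt (s : 'S_n) (x : X^n) : X^n := fun i => x (s i).

Definition perm_star (s : 'S_n) (g : XJ) : XJ := g \o star_perm s.

Lemma perm_starE (s : 'S_n) (g : XJ) i t :
  perm_star s g (star_in i t) = g (star_in (s i) t).
Proof. by rewrite /perm_star /= star_perm_in. Qed.

Lemma star_ends_equivariant (s : 'S_n) (g : XJ) :
  star_ends (perm_star s g) = perm_pt s (star_ends g).
Proof. by apply: funext => i; rewrite /star_ends perm_starE. Qed.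

Definition symmetric_set (A : set X^n) : Prop :=
  forall s : 'S_n, perm_pt s @` A = A.

Definition equivariant (A : set X^n) (f : A -> XJ) : Prop :=
  forall (s : 'S_n) (a b : A),
    val b = perm_pt s (val a) -> perm_star s (f a) = f b.

Definition equivariant_section (A : set X^n) (f : A -> XJ) : Prop :=
  [/\ continuous f, forall a : A, star_ends (f a) = val a & equivariant f].

Definition symTC_cover (k : nat) : Prop :=
  exists A : 'I_k.+1 -> set X^n,
    \bigcup_i A i = [set: X^n] /\
    forall i, [/\ open (A i), symmetric_set (A i) &
                  exists f : A i -> XJ, equivariant_section f].

(* [None] stands for infinity. *)
Definition symTC : option nat :=
  if pselect (exists k, `[< symTC_cover k >]) is left ex_k then Some (ex_minn ex_k)
  else None.

Lemma symTC_SomeP k :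
  symTC = Some k <->
  symTC_cover k /\ forall j, symTC_cover j -> (k <= j)%N.
Proof.
rewrite /symTC; case: pselect => [ex_k|nex]; last first.
  by split=> // -[ck _]; case: nex; exists k; exact/asboolP.
case: ex_minnP => m /asboolP cm minm; split=> [[<-]|[ck mink]].
  by split=> // j cj; apply/minm/asboolP.
congr Some; apply/eqP; rewrite eqn_leq mink // andbT.
exact/minm/asboolP.
Qed.

Lemma symTC_NoneP : symTC = None <-> forall k, ~ symTC_cover k.
Proof.
rewrite /symTC; case: pselect => [ex_k|nex]; split=> //.
  by have [k /asboolP ck] := ex_k => nc; case: (nc k).
by move=> _ k ck; apply: nex; exists k; exact/asboolP.
Qed.

End SymmetricTC.

(* Main.v *)
From HB Require Import structures.
From mathcomp Require Import all_boot all_order all_algebra all_fingroup.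
From mathcomp Require Import all_classical all_reals topology normedtype homotopy.
From mathcomp Require Import lra.
Require Import Defs.

(* If [H] is a homotopy from [g \o f] to the identity of [X] and [s] is an
   equivariant section over [A], then over the preimage of [A] under [f^n] the
   paths [g \o s (f x)] have a common starting point and end at [g (f (x_j))];
   appending to the [j]-th one the path [H (x_j, -)] gives an equivariant
   section.  Hence a space that is a homotopy retract of [Y] has at most the
   symmetric complexity of [Y].  Continuity in the compact-open topology goes
   through the exponential law, the star being compact Hausdorff. *)

Set Implicit Arguments.
Unset Strict Implicit.
Unset Printing Implicit Defensive.

Import Order.TTheory GRing.Theory Num.Theory.
Import numFieldNormedType.Exports.
Import ArrowAsCompactOpen.

Local Open Scope classical_set_scope.
Local Open Scope ring_scope.

(** * Continuity of composites and pasting along a closed cover *)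

Lemma continuous_comp2 (T U V W : topologicalType) (F : U * V -> W)
    (u : T -> U) (v : T -> V) :
  continuous F -> continuous u -> continuous v ->
  continuous (fun z => F (u z, v z)).
Proof.
move=> cF cu cv z.
apply: (@continuous_comp _ _ _ (fun z => (u z, v z)) F); last exact: cF.
by apply: cvg_pair; [exact: cu|exact: cv].
Qed.

Lemma continuous_comp_snd (T U V : topologicalType) (h : U -> V) :
  continuous h -> continuous (fun z : T * U => h z.2).
Proof.
move=> ch z; apply: (@continuous_comp _ _ _ snd h); last exact: ch.
exact: cvg_snd.
Qed.

Lemma continuous_comp_fst (T U V : topologicalType) (h : U -> V) :
  continuous h -> continuous (fun z : U * T => h z.1).
Proof.
move=> ch z; apply: (@continuous_comp _ _ _ fst h); last exact: ch.
exact: cvg_fst.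
Qed.

Lemma continuous_if_le (R : realType) (T U : topologicalType) (u : T -> R)
    (c : R) (F G : T -> U) :
  continuous u -> continuous F -> continuous G ->
  (forall x, u x = c -> F x = G x) ->
  continuous (fun x => if u x <= c then F x else G x).
Proof.
move=> cu cF cG FG.
have cA : closed [set x | u x <= c].
  exact: (preimage_closed (fun x _ => cu x) (@closed_le R c)).
have cB : closed [set x | c <= u x].
  exact: (preimage_closed (fun x _ => cu x) (@closed_ge R c)).
apply/continuous_subspace_setT.
(* Two closed sets cover the space, so continuity on each of them suffices. *)
have <- : [set x | u x <= c] `|` [set x | c <= u x] = setT.
  by apply/seteqP; split=> // x _; apply/orP; exact: le_total.
apply: withinU_continuous => //.
- apply: (@subspace_eq_continuous _ _ _ F); last exact: continuous_subspaceT.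
  by move=> x /set_mem uxc; rewrite /from_subspace ifT.
- apply: (@subspace_eq_continuous _ _ _ G); last exact: continuous_subspaceT.
  (* Where both inequalities hold, [u x = c] and the two branches agree. *)
  move=> x /set_mem cux; rewrite /from_subspace; case: ifP => // uxc.
  by rewrite FG //; apply/eqP; rewrite eq_le uxc.
Qed.

(** * Reparametrisations and topology of the unit interval *)

Section UnitInterval.
Variable R : realType.
Local Notation I := (unit_itv R).

Fact clamp_subproof (x : R) : Num.max 0 (Num.min 1 x) \in I.
Proof.
by rewrite inE /unit_itv /= in_itv /= le_max lexx ge_max ler01 ge_min lexx.
Qed.

(** The retraction of the line onto the interval: reparametrisations become affine formulas that
    need no range proof. *)
Definition clamp (x : R) : I :=
  exist _ (Num.max 0 (Num.min 1 x)) (clamp_subproof x).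

Lemma clamp_continuous : continuous clamp.
Proof.
apply: continuous_comp_initial => x; rewrite set_valE.
apply: (@continuous_max R R^o (cst 0) (cst 1 \min id) x).
  exact: cvg_cst.
apply: (@continuous_min R R^o (cst 1) id x); first exact: cvg_cst.
exact: cvg_id.
Qed.

Lemma clampK (t : I) : clamp (val t) = t.
Proof.
apply: val_inj; have := valP t; rewrite inE /unit_itv /= in_itv /=.
by move=> /andP[t0 t1]; rewrite (min_r t1) (max_r t0).
Qed.

Lemma clamp_le0 (x : R) : x <= 0 -> clamp x = itv0 R.
Proof.
move=> x0; apply: val_inj; apply: max_l.
by rewrite ge_min x0 orbT.
Qed.

Lemma clamp_ge1 (x : R) : 1 <= x -> clamp x = itv1 R.
Proof. by move=> x1; apply: val_inj => /=; rewrite (min_l x1) max_r. Qed.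

Lemma unit_itv_val_continuous : continuous (val : I -> R).
Proof. exact: initial_continuous. Qed.

Lemma clamp_affine_continuous (a b : R) :
  continuous (fun t : I => clamp (a * val t + b)).
Proof.
have caff : continuous (fun x : R => a * x + b).
  move=> x; apply: (@continuousD R R^o R (fun x => a * x) (cst b) x).
    exact: mulrl_continuous.
  exact: cvg_cst.
move=> t; apply: (@continuous_comp _ _ _ (fun t : I => a * val t + b) clamp).
  apply: (@continuous_comp _ _ _ (val : I -> R) (fun x => a * x + b)).
    exact: unit_itv_val_continuous.
  exact: caff.
exact: clamp_continuous.
Qed.

(** Doubled speed, then constant after the midpoint. Being defined and continuous on the whole
    interval, it suits [continuous_if_le], which asks for two globally continuous branches. *)
Definition first_half (t : I) : I := clamp (2 * val t).

Definition second_half (t : I) : I := clamp (2 * val t - 1).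

Lemma first_half_continuous : continuous first_half.
Proof.
have -> : first_half = fun t => clamp (2 * val t + 0).
  by apply/funext => t; rewrite addr0.
exact: clamp_affine_continuous.
Qed.

Lemma second_half_continuous : continuous second_half.
Proof. exact: clamp_affine_continuous. Qed.

Lemma first_half0 : first_half (itv0 R) = itv0 R.
Proof. by rewrite /first_half clamp_le0 //= mulr0. Qed.

Lemma second_half1 : second_half (itv1 R) = itv1 R.
Proof. by rewrite /second_half clamp_ge1 //=; lra. Qed.

Lemma first_half_mid (t : I) : val t = 2^-1 -> first_half t = itv1 R.
Proof. by move=> t2; rewrite /first_half clamp_ge1 // t2; lra. Qed.

Lemma second_half_mid (t : I) : val t = 2^-1 -> second_half t = itv0 R.
Proof. by move=> t2; rewrite /second_half clamp_le0 // t2; lra. Qed.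

Lemma unit_itv_compact : compact [set: I].
Proof.
(* Compactness is carried over from the segment of the real line by the retraction. *)
have -> : [set: I] = clamp @` `[0, 1]%classic.
  apply/seteqP; split=> // t _; exists (val t); last exact: clampK.
  by have /set_mem := valP t.
apply: continuous_compact; last exact: segment_compact.
exact: continuous_subspaceT clamp_continuous.
Qed.

Lemma unit_itv_hausdorff : hausdorff_space I.
Proof.
move=> x y xy; apply/val_inj/(@Rhausdorff R) => U V.
move=> /unit_itv_val_continuous nU /unit_itv_val_continuous nV.
by have [z [/= ? ?]] := xy _ _ nU nV; exists (val z).
Qed.

Lemma unit_itv_closed1 (t : I) : closed [set t].
Proof. exact/accessible_closed_set1/hausdorff_accessible/unit_itv_hausdorff. Qed.

End UnitInterval.

(** * Topology of the star and families of maps out of it *)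

Section StarTopology.
Variables (R : realType) (n : nat).
Local Notation J := (star R n).

Lemma star_in0 (i j : 'I_n) : star_in i (itv0 R) = star_in j (itv0 R).
Proof.
exact: (@wedge_liftE _ (fun=> unit_itv R) (fun=> itv0 R) _ (itv0 R) _ (itv0 R)).
Qed.

Lemma star_in_continuous (i : 'I_n) : continuous (star_in i : unit_itv R -> J).
Proof. exact: (@wedge_lift_continuous _ (fun=> unit_itv R) (fun=> itv0 R)). Qed.

Lemma star_inP (p : J) : exists i t, p = star_in i t.
Proof.
have : [set: J] p by [].
by rewrite -wedgeTE => -[i _ [t _ <-]]; exists i, t.
Qed.

Lemma star_compact : compact [set: J].
Proof.
by apply: wedge_compact => [|i]; [exact: finite_finset|exact: unit_itv_compact].
Qed.

Lemma star_hausdorff : hausdorff_space J.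
Proof. by apply: wedge_hausdorff => i; exact: unit_itv_hausdorff. Qed.

(** Together with regularity, this makes evaluation on the mapping space jointly continuous. *)
Lemma star_locally_compact : locally_compact [set: J].
Proof.
move=> p _; rewrite withinET; exists setT; first exact: filterT.
by split; [exact: star_compact|exact: closedT].
Qed.

Lemma star_regular : regular_space J.
Proof.
move=> p; apply: (compact_regular star_hausdorff star_compact).
exact: filterT.
Qed.

(** Legs that agree at the base point glue to a map on the wedge; with finitely many legs the glued
    map is jointly continuous in the parameter, and currying it gives a continuous family. *)
Lemma continuous_into_star_maps (B X : topologicalType)
    (k : 'I_n -> B -> unit_itv R -> X) :
  (forall b i j, k i b (itv0 R) = k j b (itv0 R)) ->
  (forall i, continuous (uncurry (k i))) ->
  exists2 s : B -> continuousType J X,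
    continuous s & forall b i t, s b (star_in i t) = k i b t.
Proof.
move=> k0 ck.
pose F b : J -> X := wedge_fun (k^~ b).
have cF : continuous (uncurry F).
  apply: (@wedge_fun_joint_continuous _ (fun=> unit_itv R) (fun=> itv0 R)) => //.
    exact: finite_finset.
  by move=> i; exact: unit_itv_closed1.
have [cF1 cF2] := continuous_curry cF.
pose s b : continuousType J X := mkcts (cF2 b).
(* The space of continuous maps has the initial topology for its inclusion into all functions, so
   [cF1] is enough. *)
exists s; first exact: continuous_comp_initial.
move=> b i t; rewrite -[LHS]/(F b (star_in i t)) /F /star_in.
by rewrite wedge_lift_funE.
Qed.

End StarTopology.

(** * Pulling sections back along a homotopy retract *)

Section HomotopyRetract.
Variables (R : realType) (n : nat) (X Y : topologicalType).
Variables (f : continuousType X Y) (g : continuousType Y X).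
Variable H : X * unit_itv R -> X.
Hypotheses (cH : continuous H) (H0 : forall x, H (x, itv0 R) = g (f x))
  (H1 : forall x, H (x, itv1 R) = x).

Local Notation "X ^n" := {ptws 'I_n -> X} (at level 2).

Definition map_pt (x : X^n) : Y^n := fun i => f (x i).

Lemma map_pt_continuous : continuous map_pt.
Proof.
have cfi i : continuous (f \o (proj i : X^n -> X)).
  move=> x; apply: continuous_comp; first exact: proj_continuous.
  exact: cts_fun.
(* The product topology is the supremum of the topologies induced by the projections, so each
   coordinate is checked separately. *)
move=> x; apply/cvg_sup; first exact/fmap_filter/nbhs_filter.
by move=> i; move: x; apply: continuous_comp_initial; exact: cfi.
Qed.

Lemma perm_ptV (Z : topologicalType) (s : 'S_n) (x : Z^n) :
  perm_pt s (perm_pt s^-1 x) = x.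
Proof. by apply/funext => i; rewrite /perm_pt permK. Qed.

(** Stability under every permutation includes stability under the inverse, which yields the reverse
    inclusion. *)
Lemma symmetric_setP (Z : topologicalType) (A : set Z^n) :
  symmetric_set A <-> forall s x, A x -> A (perm_pt s x).
Proof.
split=> [sA s x Ax|sA s]; first by rewrite -(sA s); exists x.
apply/seteqP; split=> [_ [x Ax <-]|x Ax]; first exact: sA.
by exists (perm_pt s^-1 x); [exact: sA|exact: perm_ptV].
Qed.

Lemma symmetric_preimage (A : set Y^n) :
  symmetric_set A -> symmetric_set (map_pt @^-1` A).
Proof. by move=> /symmetric_setP sA; apply/symmetric_setP => s x; exact: sA. Qed.

Section SectionOverPreimage.
Variables (A : set Y^n) (s : A -> continuousType (star R n) Y).
Hypothesis s_sec : equivariant_section s.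

Local Notation B := (map_pt @^-1` A).

Definition map_sub (b : B) : A :=
  exist _ (map_pt (val b)) (valP b : map_pt (val b) \in A).

Lemma map_sub_continuous : continuous map_sub.
Proof.
have cB : continuous (map_pt \o (set_val : B -> X^n)).
  move=> b; apply: continuous_comp; first exact: initial_continuous.
  exact: map_pt_continuous.
apply: continuous_comp_initial.
exact: cB.
Qed.

Definition extended_path (i : 'I_n) (b : B) (t : unit_itv R) : X :=
  if val t <= 2^-1 then g (s (map_sub b) (star_in i (first_half t)))
  else H (val b i, second_half t).

Lemma extended_path_continuous i : continuous (uncurry (extended_path i)).
Proof.
have [cs ends _] := s_sec.
have cgs : continuous (fun z : B * unit_itv R =>
    g (eval (s (map_sub z.1), star_in i (first_half z.2)))).
  have cge : continuous (g \o @eval (star R n) Y).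
    move=> w; apply: continuous_comp; last exact: cts_fun.
    exact: eval_continuous (@star_locally_compact R n) (@star_regular R n) w.
  have csm : continuous (s \o map_sub).
    by move=> b; apply: continuous_comp; [exact: map_sub_continuous|exact: cs].
  have cst : continuous (star_in i \o @first_half R).
    move=> t; apply: continuous_comp; last exact: star_in_continuous.
    exact: first_half_continuous.
  have c1 := @continuous_comp_fst (unit_itv R) _ _ _ csm.
  have c2 := @continuous_comp_snd B _ _ _ cst.
  exact: (continuous_comp2 cge c1 c2).
have cHH : continuous (fun z : B * unit_itv R =>
    H (val z.1 i, second_half z.2)).
  have cbi : continuous (proj i \o (set_val : B -> X^n)).
    move=> b; apply: continuous_comp; first exact: initial_continuous.
    exact: proj_continuous.
  have c1 := @continuous_comp_fst (unit_itv R) _ _ _ cbi.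
  have c2 := @continuous_comp_snd B _ _ _ (@second_half_continuous R).
  exact: (continuous_comp2 cH c1 c2).
have -> : uncurry (extended_path i) = fun z : B * unit_itv R =>
    if val z.2 <= 2^-1 :> R
    then g (eval (s (map_sub z.1), star_in i (first_half z.2)))
    else H (val z.1 i, second_half z.2) by apply/funext => -[].
apply: continuous_if_le => // [|z z2].
  exact: continuous_comp_snd (@unit_itv_val_continuous R).
(* At the midpoint the second branch starts at [g (f (x_i))], and the first one ends there because
   [s] is a section. *)
rewrite first_half_mid // second_half_mid // H0.
by congr (g _); exact: (congr1 (fun y : Y^n => y i) (ends (map_sub z.1))).
Qed.

Lemma extended_path0 b i j :
  extended_path i b (itv0 R) = extended_path j b (itv0 R).
Proof.
(* Time 0 falls in the first branch, where every leg sits at the base point of the star. *)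
rewrite /extended_path /= invr_ge0 ler0n first_half0.
by rewrite (star_in0 R i j).
Qed.

Lemma extended_path1 b i : extended_path i b (itv1 R) = val b i.
Proof.
rewrite /extended_path /= ifF ?second_half1 ?H1//.
by apply/negbTE; rewrite -ltNge; lra.
Qed.

Lemma equivariant_section_preimage :
  exists s' : B -> continuousType (star R n) X, equivariant_section s'.
Proof.
have [s' cs' s'E] :=
  continuous_into_star_maps extended_path0 extended_path_continuous.
exists s'; split=> // [b|p a b ab].
  by apply/funext => i; rewrite /star_ends s'E extended_path1.
(* Equivariance is checked leg by leg: the appended path depends only on the coordinate ([abi]), and
   the first part inherits equivariance from [s] ([sab]). *)
apply/continuousEP => q; have [i [t ->]] := star_inP q.
have [_ _ es] := s_sec.
have abi : val b i = val a (p i) by rewrite ab.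
have sab : perm_star p (s (map_sub a)) = s (map_sub b).
  (* Applying [f] in each coordinate commutes with permuting coordinates. *)
  by apply: es; rewrite -[LHS]/(map_pt (val b)) ab.
by rewrite perm_starE !s'E /extended_path abi -sab perm_starE.
Qed.

End SectionOverPreimage.

Lemma symTC_cover_retract k : symTC_cover R n Y k -> symTC_cover R n X k.
Proof.
move=> [A [Acov AP]]; exists (fun i => map_pt @^-1` A i); split.
  by rewrite -preimage_bigcup Acov.
move=> i; have [oA sA [s s_sec]] := AP i; split.
- by apply: open_comp => // x _; exact: map_pt_continuous.
- exact: symmetric_preimage.
- exact: equivariant_section_preimage s_sec.
Qed.

End HomotopyRetract.

(** The invariant is determined by the set of admissible [k]: its minimum, or infinity when it is
    empty. *)
Lemma symTC_eq (R : realType) (n : nat) (X Y : topologicalType) :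
  (forall k, symTC_cover R n X k <-> symTC_cover R n Y k) ->
  symTC R n X = symTC R n Y.
Proof.
move=> XY; case E: (symTC R n Y) => [k|].
  have [ck mink] := (symTC_SomeP R n Y k).1 E.
  by apply/symTC_SomeP; split=> [|j /XY]; [exact/XY|exact: mink].
apply/symTC_NoneP => k /XY ck.
exact: (symTC_NoneP R n Y).1 E k ck.
Qed.

Local Close Scope ring_scope.
Local Close Scope classical_set_scope.

Theorem proposition4p7 (R : realType) (n : nat) (hn : 2 <= n)
    (X Y : topologicalType) :
  homotopy_equivalent R X Y -> symTC R n X = symTC R n Y.
Proof.
move=> [f [g [[H [cH H0 H1]] [K [cK K0 K1]]]]].
apply: symTC_eq => k; split.
(* Each of the two homotopies makes one space a homotopy retract of the other; here [K] does so for
   [Y], which carries covers from [X] to [Y]. *)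
- exact: (@symTC_cover_retract R n Y X g f K cK K0 K1 k).
- exact: (@symTC_cover_retract R n X Y f g H cH H0 H1 k).
Qed.
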